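(* Let $\Omega\subset\mathbb{R}^2$ be a bounded convex open domain equipped with its Hilbert metric $h$, and let $f,g$ be two asymptotic geodesic lines in $\Omega$ with common boundary point $\xi=f(+\infty)=g(+\infty)\in\partial\Omega$. Assume that $\partial\Omega$ is $C^1$ at $\xi$. Then there exists a geodesic re-parametrization of $f$ (that is, a replacement of $f$ by $t\mapsto f(t+c)$ for some constant $c\in\mathbb{R}$), still denoted by $f$, such that $$\lim_{t\to\infty}h\left(f(t),g(t)\right)=0.$$
   Context: Hilbert metric: for distinct points $p,q\in\Omega$, let $p'$ and $q'$ be the intersection points of the line through $p$ and $q$ with $\partial\Omega$ which are closest to $p$ and to $q$ respectively. Then $$h(p,q)=\log\frac{|p'-q|\cdot|q'-p|}{|p'-p|\cdot|q'-q|},$$ where $|z-w|$ is the Euclidean distance; and $h(p,p)=0$. Geodesic line: a map $f:\mathbb{R}\to\Omega$ parametrized by $h$-arc length, i.e. $h(f(s),f(t))=|s-t|$ for all $s,t\in\mathbb{R}$, whose image is the intersection of $\Omega$ with a Euclidean straight line. It determines two distinct points of $\partial\Omega$, $f(+\infty)=\lim_{t\to+\infty}f(t)$ and $f(-\infty)=\lim_{t\to-\infty}f(t)$ (Euclidean limits). Two geodesic lines $f,g$ are asymptotic if $f(+\infty)=g(+\infty)$. Smoothness at a point: a support line for $\Omega$ at $\xi\in\partial\Omega$ is a line $\ell$ with $\xi\in\ell$ and $\ell\cap\Omega=\varnothing$. That $\partial\Omega$ is $C^1$ (smooth) at $\xi$ means that $\Omega$ has a unique support line at $\xi$, namely the tangent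 line to $\partial\Omega$ at $\xi$. *)

(* Defs.v *)
From HB Require Import structures.
From mathcomp Require Import all_boot all_order all_algebra.
From mathcomp Require Import all_classical all_reals all_analysis.
Set Implicit Arguments.
Unset Strict Implicit.
Unset Printing Implicit Defensive.
Import Order.TTheory GRing.Theory Num.Theory.
Import numFieldNormedType.Exports.
Local Open Scope classical_set_scope.
Local Open Scope ring_scope.

(* The norm `|_| on 'rV[R]_2 is the sup norm; it induces the usual topology
   and the usual bounded sets, but the Hilbert metric is built from the
   Euclidean distance. *)
Definition euclid_dist (R : realType) (z w : 'rV[R]_2) : R :=
  Num.sqrt (\sum_(i < 2) (z 0 i - w 0 i) ^+ 2).

Definition boundary (T : topologicalType) (A : set T) : set T :=
  closure A `\` A°.

Definition line_through (R : realType) (p q : 'rV[R]_2) : set 'rV[R]_2 :=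
  [set p + t *: (q - p) | t in [set: R]].

Definition is_line (R : realType) (l : set 'rV[R]_2) : Prop :=
  exists p q : 'rV[R]_2, p != q /\ l = line_through p q.

(* For distinct p, q in a bounded convex open set, the line through p and q
   meets the boundary in exactly two points, one beyond p and one beyond q;
   this is the one beyond p. *)
Definition hilbert_end (R : realType) (Omega : set 'rV[R]_2)
    (p q : 'rV[R]_2) : 'rV[R]_2 :=
  get [set z | [/\ boundary Omega z, line_through p q z
                 & euclid_dist z p < euclid_dist z q]].

Definition hilbert_metric (R : realType) (Omega : set 'rV[R]_2)
    (p q : 'rV[R]_2) : R :=
  if p == q then 0 else
  let p' := hilbert_end Omega p q in
  let q' := hilbert_end Omega q p in
  ln ((euclid_dist p' q * euclid_dist q' p) /
      (euclid_dist p' p * euclid_dist q' q)).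

Definition geodesic_line (R : realType) (Omega : set 'rV[R]_2)
    (f : R -> 'rV[R]_2) : Prop :=
  [/\ forall t, Omega (f t),
      forall s t, hilbert_metric Omega (f s) (f t) = `|s - t|
    & exists2 l, is_line l & range f = Omega `&` l].

Definition support_line (R : realType) (Omega : set 'rV[R]_2)
    (xi : 'rV[R]_2) (l : set 'rV[R]_2) : Prop :=
  [/\ is_line l, l xi & l `&` Omega = set0].

Definition boundary_C1_at (R : realType) (Omega : set 'rV[R]_2)
    (xi : 'rV[R]_2) : Prop :=
  exists! l, support_line Omega xi l.

(* Main.v *)
Require Import Defs.
From HB Require Import structures.
From mathcomp Require Import all_boot all_order all_algebra.
From mathcomp Require Import all_classical all_reals all_analysis.
From mathcomp Require Import ring lra.
Set Implicit Arguments.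
Unset Strict Implicit.
Unset Printing Implicit Defensive.
Import Order.TTheory GRing.Theory Num.Theory.
Import numFieldNormedType.Exports.
Local Open Scope classical_set_scope.
Local Open Scope ring_scope.

(** Along a chord of [Omega] with end points [xi] and [xi + d], the Hilbert
    distance of [xi + u *: d] and [xi + w *: d] is the difference of the
    logarithms of the odds [(1 - u) / u] and [(1 - w) / w].  A geodesic tending
    to [xi] therefore has log-odds equal to arc length up to a constant, so
    [f t] approaches [xi] at the exact rate [expR (- t)]: the rescaled curve
    [expR t *: (f t - xi)] converges to a vector [x] along the chord
    ([geodesic_blowup]).  Likewise the rescaled [g] converges to some [y], and
    replacing [f] by [t |-> f (t + c)] multiplies [x] by [expR (- c)].

    Let [tau] span the tangent line at [xi].  The vectors [x] and [y] point into
    [Omega], hence lie strictly on the same side of [tau], and a suitable [c]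
    makes their components transverse to [tau] equal.  After this, for every
    [K], the vectors [x + K *: (x - y)] and [y + K *: (y - x)] are still on that
    side.  Smoothness enters here: as the support line at [xi] is unique, every
    vector strictly on that side points from [xi] into [Omega]
    ([tangent_half_plane]).  Scaling back by [expR (- t)], for large [t] the
    segment from [f (t + c)] to [g t] can be prolonged inside [Omega] by [K]
    times its length at both ends.  This forces the Hilbert distance to be at
    most [2 / K] ([hilbert_metric_bound]), and [K] is arbitrary. *)

(** * Segments in open convex sets *)

Lemma convex_set_segment (R : realType) (A : set 'rV[R]_2) (x y : 'rV[R]_2)
  (t : R) : convex_set A -> A x -> A y -> 0 <= t <= 1 -> A (x + t *: (y - x)).
Proof.
move=> Acvx Ax Ay t01.
have := Acvx y x (Itv01 (proj1 (andP t01)) (proj2 (andP t01))).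
move=> /(_ (mem_set Ay) (mem_set Ax)) /set_mem.
congr A; apply/rowP => i; rewrite !mxE /= /unstable.onem; ring.
Qed.

(** When [w] is close to [z], the point [z + t *: (x - z)] divides a segment
    from [w] to a point [k w] in the same ratio, and [k w] is close to
    [k z = x]; some such [w] lies in [A], and then so does [k w]. *)
Lemma open_convex_segment (R : realType) (A : set 'rV[R]_2) (x z : 'rV[R]_2)
  (t : R) : open A -> convex_set A -> A x -> closure A z ->
  0 < t <= 1 -> A (z + t *: (x - z)).
Proof.
move=> Aopen Acvx Ax Az /andP[t0 t1].
pose k w : 'rV[R]_2 := x + (t^-1 - 1) *: (z - w).
have kz : k w @[w --> z] --> x.
  rewrite -[X in _ --> X]addr0 -(scaler0 _ (t^-1 - 1)) -(subrr z).
  by apply: cvgD (cvg_cst _) (cvgZl_tmp (cvgB (cvg_cst _) cvg_id)).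
have /Az[w [Aw Akw]] : nbhs z (k @^-1` A) by apply: kz; exact: open_nbhs_nbhs.
have -> : z + t *: (x - z) = w + t *: (k w - w).
  apply/rowP => i; rewrite /k !mxE; field; exact: lt0r_neq0.
by apply: convex_set_segment => //; rewrite (ltW t0).
Qed.

Lemma open_boundary_notin (T : topologicalType) (A : set T) (z : T) :
  open A -> boundary A z -> ~ A z.
Proof. by move=> /interior_id Aopen [_]; rewrite Aopen. Qed.

(** * The Hilbert metric in coordinates along a line *)

Lemma euclid_dist_line (R : realType) (p v : 'rV[R]_2) (a b : R) :
  euclid_dist (p + a *: v) (p + b *: v) = `|a - b| * euclid_dist v 0.
Proof.
rewrite /euclid_dist -sqrtr_sqr -sqrtrM ?sqr_ge0// mulr_sumr.
congr Num.sqrt; apply: eq_bigr => i _; rewrite !mxE; ring.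
Qed.

Lemma euclid_dist_gt0 (R : realType) (v : 'rV[R]_2) :
  v != 0 -> 0 < euclid_dist v 0.
Proof.
move=> /eqP v0; rewrite sqrtr_gt0 lt_neqAle sumr_ge0 ?andbT; last first.
  by move=> i _; exact: sqr_ge0.
apply/eqP => /esym/psumr_eq0P v0'; apply: v0; apply/rowP => i.
have /eqP : (v 0 i - (0 : 'rV[R]_2) 0 i) ^+ 2 = 0.
  by apply: v0' => // j _; exact: sqr_ge0.
by rewrite sqrf_eq0 !mxE subr0 => /eqP.
Qed.

(** The end beyond [p] is unique: a boundary point closer to [p] than to [p + v]
    has parameter below [1 / 2]; parameters between [0] and [1 / 2] are excluded
    by convexity, and of two boundary points behind [p] the nearer one would be
    interior to a segment joining [p] to the closure. *)
Lemma hilbert_endE (R : realType) (A : set 'rV[R]_2) (p v : 'rV[R]_2)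
  (b : R) : open A -> convex_set A -> v != 0 -> A p -> A (p + v) -> 0 < b ->
  boundary A (p - b *: v) -> hilbert_end A p (p + v) = p - b *: v.
Proof.
move=> Aopen Acvx v0 Ap Apv b0 zbd.
have line_pv z : line_through p (p + v) z -> exists r, z = p + r *: v.
  by move=> [r _ <-]; exists r; rewrite [p + v]addrC addrK.
have dist_pv r : (euclid_dist (p + r *: v) p < euclid_dist (p + r *: v) (p + v))
    = (`|r| < `|r - 1|).
  have := euclid_dist_line p v r 0; rewrite scale0r addr0 subr0 => ->.
  have := euclid_dist_line p v r 1; rewrite scale1r => ->.
  by rewrite ltr_pM2r// euclid_dist_gt0.
(* two distinct boundary points cannot lie on the same ray from p *)
have before r s : 0 < r -> r < s -> boundary A (p - r *: v) ->
    boundary A (p - s *: v) -> False.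
  move=> r0 rs /(open_boundary_notin Aopen) nAr [cs _]; apply: nAr.
  have s0 : 0 < s by exact: lt_trans rs.
  have -> : p - r *: v = (p - s *: v) + (1 - r / s) *: (p - (p - s *: v)).
    apply/rowP => i; rewrite !mxE; field; exact: lt0r_neq0.
  apply: open_convex_segment => //.
  by rewrite subr_gt0 ltr_pdivrMr// mul1r rs/= gerBl divr_ge0 ?ltW.
rewrite /hilbert_end.
set P := (P in get P).
have Pz : P (p - b *: v).
  split=> //.
    by exists (- b) => //; rewrite scaleNr [p + v]addrC addrK.
  by rewrite -scaleNr dist_pv !ltr0_norm; lra.
have [] := getPex (ex_intro P _ Pz).
move: (get P) => z zbd' /line_pv[r zE]; rewrite zE dist_pv => rlt.
rewrite zE in zbd'.
have r0 : r < 0.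
  rewrite ltNge; apply/negP => r0.
  apply: (open_boundary_notin Aopen zbd').
  have r1 : r < 1.
    rewrite ltNge; apply/negP => r1.
    by move: rlt; rewrite !ger0_norm ?subr_ge0//; lra.
  have := @convex_set_segment _ _ p (p + v) r Acvx Ap Apv.
  by rewrite [p + v]addrC addrK; apply; rewrite r0 ltW.
rewrite -[in LHS](opprK r) scaleNr; congr (p - _ *: v).
rewrite -[r]opprK scaleNr in zbd'.
have [rb|br|//] := ltgtP (- r) b.
  by exfalso; apply: (before (- r) b) => //; rewrite oppr_gt0.
by exfalso; apply: (before b (- r)).
Qed.

Lemma hilbert_metricE (R : realType) (A : set 'rV[R]_2) (p v : 'rV[R]_2)
  (a b : R) : open A -> convex_set A -> v != 0 -> A p -> A (p + v) ->
  0 < a -> boundary A (p - a *: v) ->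
  0 < b -> boundary A (p + v + b *: v) ->
  hilbert_metric A p (p + v) = ln ((1 + a^-1) * (1 + b^-1)).
Proof.
move=> Aopen Acvx v0 Ap Apv a0 abd b0 bbd.
rewrite /hilbert_metric -subr_eq0 opprD addrA subrr sub0r oppr_eq0 (negPf v0).
rewrite (@hilbert_endE _ _ _ _ a)//.
have : hilbert_end A (p + v) (p + v + - v) = p + v - b *: - v.
  by apply: hilbert_endE; rewrite ?oppr_eq0 ?addrK ?scalerN ?opprK.
rewrite addrK => ->.
have -> : p + v - b *: - v = p + (1 + b) *: v.
  by rewrite scalerN opprK scalerDl scale1r addrA.
have dl r s := euclid_dist_line p v r s.
have := dl (- a) 0; rewrite scale0r addr0 scaleNr => ->.
have := dl (1 + b) 0; rewrite scale0r addr0 => ->.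
have := dl (- a) 1; rewrite scale1r scaleNr => ->.
have := dl (1 + b) 1; rewrite scale1r => ->.
have := euclid_dist_gt0 v0; move: (euclid_dist v 0) => N N0.
have -> : `|- a - 1| = 1 + a by rewrite ltr0_norm; lra.
have -> : `|1 + b - 0| = 1 + b by rewrite subr0 gtr0_norm; lra.
have -> : `|- a - 0| = a by rewrite subr0 ltr0_norm; lra.
have -> : `|1 + b - 1| = b by rewrite gtr0_norm; lra.
by congr ln; field; rewrite !lt0r_neq0.
Qed.

(** The boundary point is found at the supremum of the parameters, of either
    sign, whose point lies in [A]: these form an open subset of the real line,
    which cannot contain its supremum. *)
Lemma ray_meets_boundary (R : realType) (A : set 'rV[R]_2) (p v : 'rV[R]_2) :
  open A -> bounded_set A -> A p -> v != 0 ->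
  exists2 a : R, 0 < a & boundary A (p + a *: v).
Proof.
move=> Aopen Abd Ap v0.
pose ray (r : R) : 'rV[R]_2 := p + r *: v.
have ray_cts : continuous ray.
  by move=> r; exact: cvgD (cvg_cst _) (cvgZr_tmp cvg_id).
pose E := ray @^-1` A.
have Eopen : open E by exact: open_comp.
have E0 : E 0 by rewrite /E /= /ray scale0r addr0.
have Esup : has_sup E.
  split; first by exists 0.
  have [M [_ /(_ (M + 1)) AM]] := Abd.
  exists ((M + 1 + `|p|) / `|v|) => r Er.
  rewrite ler_pdivlMr ?normr_gt0//; apply: le_trans (_ : `|r| * `|v| <= _).
    by rewrite ler_wpM2r// ler_norm.
  rewrite -normrZ; have -> : r *: v = ray r - p by rewrite /ray addrC addKr.
  rewrite (le_trans (ler_normB _ _))// lerD2r.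
  by apply: AM => //; rewrite ltrDl.
have nEs : ~ E (sup E).
  move=> Es; have /nbhs_ballP[e /= e0 eE] := open_nbhs_nbhs (conj Eopen Es).
  have : E (sup E + e / 2).
    apply: eE; rewrite /ball /= opprD addNKr normrN.
    by rewrite gtr0_norm ?divr_gt0//; lra.
  by move=> /(ub_le_sup (proj2 Esup)); lra.
exists (sup E).
  rewrite lt_neqAle (ub_le_sup (proj2 Esup) E0) andbT.
  by apply/eqP => s0; apply: nEs; rewrite -s0.
split; last by rewrite (interior_id _).1.
move=> B Bs; have /nbhs_ballP[e /= e0 eB] := ray_cts (sup E) _ Bs.
have [r Er re] := sup_adherent e0 Esup.
exists (ray r); split=> //; apply: eB; rewrite /ball /=.
by rewrite ger0_norm ?subr_ge0 ?(ub_le_sup (proj2 Esup))//; lra.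
Qed.

(** In terms of the ratios [a], [b] by which the segment must be prolonged to
    reach the boundary, the distance is [ln (1 + a^-1) + ln (1 + b^-1)]; the
    hypotheses say that [a] and [b] are at least [K]. *)
Lemma hilbert_metric_bound (R : realType) (A : set 'rV[R]_2) (p q : 'rV[R]_2)
  (K : R) : open A -> convex_set A -> bounded_set A -> A p -> A q -> 0 < K ->
  A (p + K *: (p - q)) -> A (q + K *: (q - p)) ->
  0 <= hilbert_metric A p q <= 2 / K.
Proof.
move=> Aopen Acvx Abd Ap Aq K0 AKp AKq.
have [->|pq] := eqVneq p q.
  by rewrite /hilbert_metric eqxx lexx divr_ge0// ltW.
have v0 : q - p != 0 by rewrite subr_eq0 eq_sym.
have far z w a : A z -> A (z + K *: w) -> 0 < a -> boundary A (z + a *: w) ->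
    a^-1 <= K^-1.
  move=> Az Aw a0 /(open_boundary_notin Aopen) nAa.
  rewrite lef_pV2 ?posrE// leNgt; apply/negP => aK; apply: nAa.
  have := convex_set_segment (t := a / K) Acvx Az Aw.
  rewrite [z + K *: w]addrC addrK scalerA mulfVK ?gt_eqF//; apply.
  by rewrite (divr_ge0 (ltW a0) (ltW K0)) ler_pdivrMr// mul1r ltW.
have [b b0 bbd] := ray_meets_boundary Aopen Abd Aq v0.
have nv0 : p - q != 0 by rewrite subr_eq0.
have [a a0 abd] := ray_meets_boundary Aopen Abd Ap nv0.
have aK := far _ _ _ Ap AKp a0 abd.
have bK := far _ _ _ Aq AKq b0 bbd.
have abd' : boundary A (p - a *: (q - p)) by rewrite -scalerN opprB.
have := @hilbert_metricE _ A p (q - p) a b Aopen Acvx v0 Ap.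
rewrite [p + _]addrC subrK => ->//.
have a'0 : 0 < a^-1 by rewrite invr_gt0.
have b'0 : 0 < b^-1 by rewrite invr_gt0.
have pa : 0 < 1 + a^-1 by rewrite addr_gt0.
have pb : 0 < 1 + b^-1 by rewrite addr_gt0.
apply/andP; split.
  by rewrite ln_ge0// mulr_ege1// lerDl ltW.
rewrite (lnM pa pb).
rewrite mulrDl mul1r lerD//.
  by rewrite (le_trans _ aK)// le_ln1Dx//; lra.
by rewrite (le_trans _ bK)// le_ln1Dx//; lra.
Qed.

Lemma hilbert_metricC (R : realType) (A : set 'rV[R]_2) (p q : 'rV[R]_2) :
  hilbert_metric A p q = hilbert_metric A q p.
Proof.
rewrite /hilbert_metric eq_sym; case: eqP => // _.
by congr (ln (_ / _)); rewrite mulrC.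
Qed.

(** A point of [A] outside the open chord would enclose one of the two end
    points between itself and [xi + k *: d]. *)
Lemma chord_coord (R : realType) (A : set 'rV[R]_2) (xi d : 'rV[R]_2)
  (k u : R) : open A -> convex_set A ->
  boundary A xi -> boundary A (xi + d) ->
  0 < k < 1 -> A (xi + k *: d) -> A (xi + u *: d) -> 0 < u < 1.
Proof.
move=> Aopen Acvx /(open_boundary_notin Aopen) nAxi.
move=> /(open_boundary_notin Aopen) nAd /andP[k0 k1] Ak Au.
apply/andP; split; rewrite ltNge; apply/negP => hu.
- apply: nAxi; have uk : 0 < k - u by lra.
  have -> : xi = xi + u *: d
      + (- u / (k - u)) *: (xi + k *: d - (xi + u *: d)).
    by apply/rowP => i; rewrite !mxE; field; rewrite lt0r_neq0.
  apply: convex_set_segment => //.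
  by rewrite divr_ge0 ?ler_pdivrMr//=; lra.
- apply: nAd; have uk : 0 < u - k by lra.
  have -> : xi + d = xi + u *: d
      + ((u - 1) / (u - k)) *: (xi + k *: d - (xi + u *: d)).
    by apply/rowP => i; rewrite !mxE; field; rewrite lt0r_neq0.
  apply: convex_set_segment => //.
  by rewrite divr_ge0 ?ler_pdivrMr//=; lra.
Qed.

(** With [a = u / (w - u)] and [b = (1 - w) / (w - u)], the left-hand side is
    [(1 + a^-1) * (1 + b^-1)], and the right-hand side separates the two
    points, which turns the metric into a difference after taking [ln]. *)
Lemma cross_ratioE (R : realFieldType) (u w : R) : 0 < u -> u < w -> w < 1 ->
  (1 + (w - u) / u) * (1 + (w - u) / (1 - w)) = (1 - u) / u / ((1 - w) / w).
Proof.
move=> u0 uw w1.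
have [u0' w0' w1'] : [/\ u != 0, w != 0 & 1 - w != 0].
  by split; apply: lt0r_neq0; lra.
by field; do ?[apply/andP; split].
Qed.

Lemma ler_odds (R : realFieldType) (u w : R) : 0 < u -> u <= w ->
  (1 - w) / w <= (1 - u) / u.
Proof.
move=> u0 uw; have w0 : 0 < w by lra.
rewrite ler_pdivlMr// mulrAC ler_pdivrMr//.
lra.
Qed.

Lemma hilbert_metric_chord (R : realType) (A : set 'rV[R]_2) (xi d : 'rV[R]_2)
  (u w : R) : open A -> convex_set A -> boundary A xi -> boundary A (xi + d) ->
  d != 0 -> A (xi + u *: d) -> A (xi + w *: d) -> 0 < u < 1 -> 0 < w < 1 ->
  hilbert_metric A (xi + u *: d) (xi + w *: d)
    = `|ln ((1 - u) / u) - ln ((1 - w) / w)|.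
Proof.
move=> Aopen Acvx xibd dbd d0.
wlog uw : u w / u <= w.
  move=> H Au Aw u01 w01; have [uw|/ltW wu] := leP u w; first exact: H.
  by rewrite hilbert_metricC distrC; exact: H.
move=> Au Aw /andP[u0 u1] /andP[w0 w1].
move: uw; rewrite le_eqVlt => /predU1P[<-|uw].
  by rewrite subrr normr0 /hilbert_metric eqxx.
have uw0 : 0 < w - u by rewrite subr_gt0.
have uw0' : w - u != 0 by rewrite gt_eqF.
have wE : xi + u *: d + (w - u) *: d = xi + w *: d.
  by rewrite -addrA -scalerDl [u + _]addrC subrK.
have pu : 0 < (1 - u) / u by rewrite divr_gt0// subr_gt0.
have pw : 0 < (1 - w) / w by rewrite divr_gt0// subr_gt0.
have v0 : (w - u) *: d != 0 by rewrite scaler_eq0 negb_or d0 uw0'.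
have a0 : 0 < u / (w - u) by rewrite divr_gt0.
have b0 : 0 < (1 - w) / (w - u) by rewrite divr_gt0// subr_gt0.
have abd : boundary A (xi + u *: d - (u / (w - u)) *: ((w - u) *: d)).
  rewrite scalerA (mulfVK uw0') addrK; exact: xibd.
have bbd : boundary A
    (xi + u *: d + (w - u) *: d + ((1 - w) / (w - u)) *: ((w - u) *: d)).
  rewrite scalerA (mulfVK uw0') wE -addrA -scalerDl [w + _]addrC subrK scale1r.
  exact: dbd.
have Aw' : A (xi + u *: d + (w - u) *: d) by rewrite wE; exact: Aw.
rewrite -wE.
rewrite (hilbert_metricE Aopen Acvx v0 Au Aw' a0 abd b0 bbd).
rewrite !invf_div cross_ratioE// (ln_div pu pw) ger0_norm//.
by rewrite subr_ge0 (ler_ln pw pu) ler_odds// ltW.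
Qed.

(** * Lines through a point and the cross product *)

Definition cross (R : realType) (u v : 'rV[R]_2) : R :=
  u 0 0 * v 0 1 - u 0 1 * v 0 0.

Lemma cross_line (R : realType) (u v : 'rV[R]_2) :
  v != 0 -> cross u v = 0 -> exists r, u = r *: v.
Proof.
move=> v0 uv0.
have ord2 (i : 'I_2) : i = 0 \/ i = 1.
  by case: i => [[|[|//]] lti]; [left|right]; exact: val_inj.
have [v00|v00] := eqVneq (v 0 0) 0; last first.
  exists (u 0 0 / v 0 0); apply/rowP => i; rewrite !mxE.
  case: (ord2 i) => ->; first by rewrite mulfVK.
  by apply: (mulIf v00); rewrite mulrAC mulfVK//; apply/esym/subr0_eq.
have v01 : v 0 1 != 0.
  apply: contra_neq v0 => v01; apply/rowP => i; rewrite mxE.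
  by case: (ord2 i) => ->.
exists (u 0 1 / v 0 1); apply/rowP => i; rewrite !mxE.
case: (ord2 i) => ->; last by rewrite mulfVK.
apply/eqP; rewrite v00 mulr0 -(mulIr_eq0 _ (mulIf v01)).
by move: uv0; rewrite /cross v00 mulr0 subr0 => ->.
Qed.

Lemma crossZl (R : realType) (a : R) (u v : 'rV[R]_2) :
  cross (a *: u) v = a * cross u v.
Proof. by rewrite /cross !mxE; ring. Qed.

Lemma crossDl (R : realType) (u u' v : 'rV[R]_2) :
  cross (u + u') v = cross u v + cross u' v.
Proof. by rewrite /cross !mxE; ring. Qed.

Lemma crossBl (R : realType) (u u' v : 'rV[R]_2) :
  cross (u - u') v = cross u v - cross u' v.
Proof. by rewrite /cross !mxE; ring. Qed.

Lemma cross_continuous (R : realType) (v : 'rV[R]_2) :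
  continuous (fun u => cross u v).
Proof.
move=> u.
exact: cvgB (cvgMr_tmp (@coord_continuous _ _ _ 0 0 u))
            (cvgMr_tmp (@coord_continuous _ _ _ 0 1 u)).
Qed.

Lemma line_direction (R : realType) (l : set 'rV[R]_2) (xi : 'rV[R]_2) :
  is_line l -> l xi ->
  exists2 tau : 'rV[R]_2, tau != 0 &
    forall z, l z <-> cross (z - xi) tau = 0.
Proof.
move=> [p [q [pq ->]]] [r _ <-].
have tau0 : q - p != 0 by rewrite subr_eq0 eq_sym.
exists (q - p) => // z; split=> [[s _ <-]|/(cross_line tau0)[s zE]].
  by rewrite /cross !mxE; ring.
exists (s + r) => //.
by rewrite scalerDl -zE addrCA subrK.
Qed.

(** * Geodesics tending to a boundary point *)

(** Comparing both [t] and [0] with one far point [s], where the signs of all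
    differences are known, removes the absolute values. *)
Lemma real_isometry_pinfty (R : realType) (L : R -> R) :
  (forall s t, `|L s - L t| = `|s - t|) -> L s @[s --> +oo] --> +oo ->
  forall t, L t = L 0 + t.
Proof.
move=> Liso Loo t.
near (pinfty_nbhs R) => s.
have s0 : 0 < s by near: s; exact: nbhs_pinfty_gt.
have st : t < s by near: s; apply: nbhs_pinfty_gt; rewrite num_real.
have L0 : L 0 < L s by near: s; exact: cvgry_gt.
have Lt : L t < L s by near: s; exact: cvgry_gt.
have := Liso s t; have := Liso s 0.
rewrite !ger0_norm ?subr_ge0 ?ltW//; lra.
Unshelve. all: by end_near. Qed.

(** The vector [d] joins [xi] to the other end of the chord, and [c] is the
    log-odds of [f 0]; the formula inverts [ln ((1 - u) / u) = t + c]. *)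
Lemma geodesic_param (R : realType) (A : set 'rV[R]_2) (f : R -> 'rV[R]_2)
  (xi : 'rV[R]_2) :
  open A -> convex_set A -> bounded_set A -> geodesic_line A f ->
  boundary A xi -> f t @[t --> +oo] --> xi ->
  exists d : 'rV[R]_2, exists c : R,
    forall t, f t = xi + (1 + expR (t + c))^-1 *: d.
Proof.
move=> Aopen Acvx Abd [fA fiso [l lline fl]] xibd fxi.
have fl' t : l (f t).
  have : range f (f t) by exists t.
  by rewrite fl => -[].
have [tau tau0 ltau] := line_direction lline (fl' 0).
(* The line is closed, so its direction tau also joins xi to every f t. *)
have xil t : cross (f t - xi) tau = 0.
  have ft0 s : cross (f s - f 0) tau = 0 by exact: (ltau (f s)).1.
  have xi0 : cross (xi - f 0) tau = 0.
    have h : cross (f s - f 0) tau @[s --> +oo] --> cross (xi - f 0) tau.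
      apply: (cvg_comp (fun s => f s - f 0) (fun z => cross z tau)).
        exact: cvgB fxi (cvg_cst _).
      exact: cross_continuous.
    have e : (fun s => cross (f s - f 0) tau) = (fun=> 0) by apply/funext.
    by rewrite e in h; exact: (cvg_unique _ h (cvg_cst 0)).
  have -> : f t - xi = (f t - f 0) - (xi - f 0).
    by rewrite opprB addrA subrK.
  by rewrite crossBl ft0 xi0 subrr.
have nAxi := open_boundary_notin Aopen xibd.
have v0 : f 0 - xi != 0.
  by rewrite subr_eq0; apply/eqP => e; apply: nAxi; rewrite -e.
have [a a0 abd] := ray_meets_boundary Aopen Abd (fA 0) v0.
pose d := (1 + a) *: (f 0 - xi).
have a1 : 1 + a != 0 by rewrite gt_eqF// addr_gt0.
have d0 : d != 0 by rewrite scaler_eq0 negb_or a1 v0.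
have dbd : boundary A (xi + d).
  have -> : xi + d = f 0 + a *: (f 0 - xi).
    by rewrite /d scalerDl scale1r addrA [xi + _]addrC subrK.
  exact: abd.
have f0d : f 0 = xi + (1 + a)^-1 *: d.
  by rewrite /d scalerA mulVf// scale1r addrC subrK.
have kd : 0 < (1 + a)^-1 < 1.
  by rewrite invr_gt0 invf_lt1 ?ltrDl ?addr_gt0// a0.
have [u uP] : {u : R -> R & forall t, 0 < u t < 1 /\ f t = xi + u t *: d}.
  apply: (@choice _ _ (fun t r => 0 < r < 1 /\ f t = xi + r *: d)) => t.
  have [r0 r0E] := cross_line tau0 (xil 0).
  have [r rE] := cross_line tau0 (xil t).
  have r00 : r0 != 0.
    by apply: contra_neq v0 => r00; rewrite r0E r00 scale0r.
  pose u := r / r0 / (1 + a).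
  have ftE : f t = xi + u *: d.
    rewrite /d scalerA /u (mulfVK a1) r0E scalerA (mulfVK r00) -rE.
    by rewrite addrC subrK.
  exists u; split; last exact: ftE.
  apply: (@chord_coord _ A xi d (1 + a)^-1 u Aopen Acvx xibd dbd kd).
    by rewrite -f0d; exact: fA.
  by rewrite -ftE; exact: fA.
have u0 t : 0 < u t by have [/andP[]] := uP t.
have u1 t : u t < 1 by have [/andP[]] := uP t.
have fE t : f t = xi + u t *: d by have [] := uP t.
pose L t := ln ((1 - u t) / u t).
have odds0 t : 0 < (1 - u t) / u t by rewrite divr_gt0// subr_gt0.
have Liso s t : `|L s - L t| = `|s - t|.
  rewrite -(fiso s t) !fE.
  have Au r : A (xi + u r *: d) by rewrite -fE; exact: fA.
  have u01 r : 0 < u r < 1 by rewrite u0 u1.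
  by rewrite (hilbert_metric_chord Aopen Acvx xibd dbd d0 (Au s) (Au t)).
have u_cvg0 : u t @[t --> +oo] --> 0.
  apply/cvgr0Pnorm_lt => e e0.
  have ed : 0 < e * `|d| by rewrite mulr_gt0// normr_gt0.
  apply: filterS (cvgr_distC_lt _ _ fxi _ ed) => t.
  by rewrite fE addrC addKr normrZ ltr_pM2r ?normr_gt0.
have Loo : L t @[t --> +oo] --> +oo.
  apply/cvgryPgt => M.
  have M0 : 0 < (1 + expR M)^-1 by rewrite invr_gt0 addr_gt0 ?expR_gt0.
  apply: filterS (cvgr_lt _ u_cvg0 _ M0) => t utM.
  rewrite -[M]expRK /L ltr_ln ?posrE ?expR_gt0// ltr_pdivlMr//.
  move: utM; rewrite -[_^-1]mul1r ltr_pdivlMr ?addr_gt0 ?expR_gt0//.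
  by rewrite mulrDr mulr1 ltrBrDl [expR M * _]mulrC.
exists d, (L 0) => t; rewrite fE; congr (_ + _ *: _).
have := real_isometry_pinfty Liso Loo t.
rewrite addrC => <-; rewrite /L lnK ?posrE//.
have -> : 1 + (1 - u t) / u t = (u t)^-1 by field; rewrite gt_eqF.
by rewrite invrK.
Qed.

(** The limit is written as a positive multiple of [f 0 - xi] because all that
    matters about it is on which side of the tangent it lies, and there [f 0] is
    a point of [A]. *)
Lemma geodesic_blowup (R : realType) (A : set 'rV[R]_2) (f : R -> 'rV[R]_2)
  (xi : 'rV[R]_2) :
  open A -> convex_set A -> bounded_set A -> geodesic_line A f ->
  boundary A xi -> f t @[t --> +oo] --> xi ->
  exists2 k : R, 0 < k &
    expR t *: (f t - xi) @[t --> +oo] --> k *: (f 0 - xi).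
Proof.
move=> Aopen Acvx Abd fgeo xibd fxi.
have [d [c fE]] := geodesic_param Aopen Acvx Abd fgeo xibd fxi.
exists ((expR c)^-1 * (1 + expR c)).
  by rewrite mulr_gt0 ?invr_gt0 ?addr_gt0 ?expR_gt0.
have c0 : 1 + expR c != 0 by rewrite gt_eqF// addr_gt0 ?expR_gt0.
have -> : ((expR c)^-1 * (1 + expR c)) *: (f 0 - xi) = (0 + expR c)^-1 *: d.
  by rewrite fE [xi + _]addrC addrK scalerA (add0r c) add0r (mulfK c0).
have -> : (fun t => expR t *: (f t - xi))
        = (fun t => (expR (- t) + expR c)^-1 *: d).
  apply/funext => t; rewrite fE [xi + _]addrC addrK scalerA; congr (_ *: _).
  rewrite expRN expRD; field.
  by rewrite !gt_eqF ?addr_gt0 ?mulr_gt0 ?expR_gt0.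
apply: cvgZr_tmp; apply: cvgV; first by rewrite add0r gt_eqF ?expR_gt0.
exact: cvgD (@cvgr_expR R) (cvg_cst _).
Qed.

(** * The tangent cone at a smooth boundary point *)

(** The vector [tau] directs the unique support line, oriented so that [A] lies
    on its positive side.  If [0 < cross w tau], the line through [xi] directed
    by [w] is another line, hence not a support line, so it meets [A]; it does
    so on the positive side, that is at a positive parameter. *)
Lemma tangent_half_plane (R : realType) (A : set 'rV[R]_2) (xi : 'rV[R]_2) :
  A !=set0 -> convex_set A -> boundary_C1_at A xi ->
  exists tau : 'rV[R]_2,
    (forall z, A z -> 0 < cross (z - xi) tau) /\
    (forall w, 0 < cross w tau -> exists2 s : R, 0 < s & A (xi + s *: w)).
Proof.
move=> [x0 Ax0] Acvx [l [[lline lxi lA] lmin]].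
have [tau1 tau10 ltau] := line_direction lline lxi.
have cA z : A z -> cross (z - xi) tau1 != 0.
  move=> Az; apply/eqP => /ltau lz.
  by have : (l `&` A) z by []; rewrite lA.
(* The sign at x0 orients tau. *)
pose sg := Num.sg (cross (x0 - xi) tau1).
have sg0 : sg != 0 by rewrite sgr_eq0 cA.
have crossZr (b : R) u v : cross u (b *: v) = b * cross u v.
  by rewrite /cross !mxE; ring.
exists (sg *: tau1).
have pos z : A z -> 0 < cross (z - xi) (sg *: tau1).
  move=> Az; rewrite crossZr ltNge; apply/negP => zle.
  have x0pos : 0 < sg * cross (x0 - xi) tau1.
    by rewrite /sg -normrEsg normr_gt0 cA.
  set a := sg * cross (z - xi) tau1 in zle.
  set b := sg * cross (x0 - xi) tau1 in x0pos.
  have ba : 0 < b - a by lra.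
  (* t is the parameter at which the segment from z to x0 meets the line. *)
  pose t := - a / (b - a).
  have tE : a + t * (b - a) = 0 by rewrite /t mulfVK ?gt_eqF// subrr.
  have : A (z + t *: (x0 - z)).
    apply: convex_set_segment => //.
    by rewrite divr_ge0 ?ler_pdivrMr//=; lra.
  move=> /cA/eqP; apply; apply: (mulfI sg0).
  have -> : z + t *: (x0 - z) - xi = (z - xi) + t *: ((x0 - xi) - (z - xi)).
    by apply/rowP => i; rewrite !mxE; ring.
  by rewrite crossDl crossZl (crossBl (x0 - xi)) mulr0 -tE /a /b; ring.
split=> // w w0.
have nw : w != 0.
  by apply: contraTneq w0 => ->; rewrite /cross !mxE !mul0r subrr ltxx.
pose lw := line_through xi (xi + w).
have lwE r : lw (xi + r *: w) by exists r => //; rewrite [xi + w]addrC addrK.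
have lwline : is_line lw.
  exists xi, (xi + w); split=> //.
  by rewrite -subr_eq0 opprD addNKr oppr_eq0.
have [s As] : exists s, A (xi + s *: w).
  apply: contrapT => nA.
  have /lmin llw : support_line A xi lw.
    split=> //; first by have := lwE 0; rewrite scale0r addr0.
    apply/seteqP; split=> // z [[r _ <-] Az]; apply: nA; exists r.
    by move: Az; rewrite [xi + w]addrC addrK.
  have := lwE 1; rewrite -llw scale1r => /ltau.
  rewrite addrC addKr => w0'; move: w0.
  by rewrite crossZr w0' mulr0 ltxx.
exists s => //; have := pos _ As.
by rewrite addrC addKr crossZl pmulr_lgt0.
Qed.

(** * Asymptotic geodesics *)

Theorem proposition2 (R : realType) (Omega : set 'rV[R]_2)
  (Omega_neq0 : Omega !=set0) (Omega_open : open Omega)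
  (Omega_convex : convex_set Omega) (Omega_bounded : bounded_set Omega)
  (f g : R -> 'rV[R]_2) (xi : 'rV[R]_2)
  (f_geodesic : geodesic_line Omega f) (g_geodesic : geodesic_line Omega g)
  (xi_boundary : boundary Omega xi)
  (f_xi : f t @[t --> +oo] --> xi) (g_xi : g t @[t --> +oo] --> xi)
  (Omega_C1 : boundary_C1_at Omega xi) :
  exists c : R, hilbert_metric Omega (f (t + c)) (g t) @[t --> +oo] --> (0 : R).
Proof.
have [k k0 fk] := geodesic_blowup Omega_open Omega_convex Omega_bounded
  f_geodesic xi_boundary f_xi.
have [m m0 gm] := geodesic_blowup Omega_open Omega_convex Omega_bounded
  g_geodesic xi_boundary g_xi.
have [tau [taupos tauin]] :=
  tangent_half_plane Omega_neq0 Omega_convex Omega_C1.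
have fO t : Omega (f t) by have [] := f_geodesic.
have gO t : Omega (g t) by have [] := g_geodesic.
set x := k *: (f 0 - xi) in fk.
set y := m *: (g 0 - xi) in gm.
have x0 : 0 < cross x tau by rewrite crossZl mulr_gt0// taupos.
have y0 : 0 < cross y tau by rewrite crossZl mulr_gt0// taupos.
pose r := cross y tau / cross x tau.
have r0 : 0 < r by rewrite divr_gt0.
(* Shifting f by - ln r multiplies x by r, which equalizes the components of x
   and y transverse to the tangent. *)
exists (- ln r).
pose P t : 'rV[R]_2 := expR t *: (f (t - ln r) - xi).
pose Q t : 'rV[R]_2 := expR t *: (g t - xi).
have Px : P t @[t --> +oo] --> r *: x.
  have -> : P = (fun t => r *: (expR (t - ln r) *: (f (t - ln r) - xi))).
    apply/funext => t; rewrite /P scalerA; congr (_ *: _).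
    by rewrite expRD expRN lnK ?posrE// mulrCA mulfV ?gt_eqF// mulr1.
  apply: cvgZl_tmp.
  by rewrite (@cvg_centerr R (ln r) _ (fun t => expR t *: (f t - xi))).
have Qy : Q t @[t --> +oo] --> y by exact: gm.
have xy : cross (r *: x) tau = cross y tau.
  by rewrite crossZl /r mulfVK// gt_eqF.
(* The blown-up point u + K (u - v) is on the inner side of the tangent, so a
   multiple s of it leads into Omega; nearby vectors do as well, and multiples
   smaller than s by convexity. *)
have extend (K : R) (U V : R -> 'rV[R]_2) u v :
    U t @[t --> +oo] --> u -> V t @[t --> +oo] --> v ->
    cross u tau = cross v tau -> 0 < cross v tau ->
    \forall t \near +oo,
      Omega (xi + expR (- t) *: (U t + K *: (U t - V t))).
  move=> Uu Vv uv v0.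
  have [s s0 As] : exists2 s : R, 0 < s & Omega (xi + s *: (u + K *: (u - v))).
    by apply: tauin; rewrite crossDl crossZl crossBl uv subrr mulr0 addr0.
  have near_s : \forall t \near +oo,
      Omega (xi + s *: (U t + K *: (U t - V t))).
    have lim_s : xi + s *: (U t + K *: (U t - V t)) @[t --> +oo]
        --> xi + s *: (u + K *: (u - v)).
      exact: cvgD (cvg_cst _)
        (cvgZl_tmp (cvgD Uu (cvgZl_tmp (cvgB Uu Vv)))).
    by apply: lim_s; exact: open_nbhs_nbhs.
  have small : \forall t \near +oo, expR (- t) < s.
    exact: cvgr_lt _ (@cvgr_expR R) _ s0.
  apply: filterS2 near_s small => t Ast es.
  set w := U t + _ in Ast *.
  have -> : xi + expR (- t) *: w
      = xi + (expR (- t) / s) *: (xi + s *: w - xi).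
    by rewrite [xi + s *: w]addrC addrK scalerA mulfVK ?gt_eqF.
  apply: open_convex_segment => //; first by case: xi_boundary.
  by rewrite divr_gt0 ?expR_gt0//= ler_pdivrMr// mul1r ltW.
have unscale t (z : 'rV[R]_2) : expR (- t) *: (expR t *: z) = z.
  by rewrite scalerA -expRD addNr expR0 scale1r.
have pE (K : R) t (z w : 'rV[R]_2) :
    xi + expR (- t) *: (expR t *: (z - xi)
      + K *: (expR t *: (z - xi) - expR t *: (w - xi))) = z + K *: (z - w).
  rewrite -scalerBr [K *: _]scalerA [K * _]mulrC -scalerA -scalerDr unscale.
  by apply/rowP => i; rewrite !mxE; ring.
apply/cvgrPdist_le => e e0.
pose K := 2 / e.
have K0 : 0 < K by rewrite divr_gt0.
have y0' : 0 < cross (r *: x) tau by rewrite xy.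
apply: filterS2 (extend K P Q _ _ Px Qy xy y0)
  (extend K Q P _ _ Qy Px (esym xy) y0') => t.
rewrite /P /Q !pE => Ap Aq.
have /andP[h0 hK] := hilbert_metric_bound Omega_open Omega_convex Omega_bounded
  (fO (t - ln r)) (gO t) K0 Ap Aq.
rewrite sub0r normrN ger0_norm//; apply: le_trans hK _.
by rewrite /K invf_div mulrCA mulfV// mulr1.
Qed.
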